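(* Let $\kappa$ be an infinite cardinal. Every $(<\kappa)$-octahedral real normed space $X$ of density $\kappa$ satisfies $\gamma^*(X)=1$. In particular, every separable octahedral normed space $X$ satisfies $\gamma^*(X)=1$.
   Context: $S_X$ denotes the unit sphere of $X$. $\mathrm{dens}(X)$, the density of $X$, is the smallest cardinality of a subset of $X$ whose linear span is dense in $X$ (so $\mathrm{dens}(Z)<\omega$ means $Z$ is finite-dimensional). For an infinite cardinal $\kappa$, a normed space $X$ is $(<\kappa)$-octahedral if for every subspace $Z$ of $X$ with $\mathrm{dens}(Z)<\kappa$ and every $\varepsilon>0$ there is $x\in S_X$ such that $\|z+\lambda x\|\ge(1-\varepsilon)(\|z\|+|\lambda|)$ for every $z\in Z$ and $\lambda\in\mathbb{R}$; octahedral means $(<\omega)$-octahedral. A set $P\subseteq X$ is $r$-separated if $\|x-y\|\ge r$ for all distinct $x,y\in P$, and $r$-dense if for every $x\in X$ there is $p\in P$ with $\|x-p\|\le r$. $\gamma^*(X)=\inf\{r>0:\text{there exists an }r\text{-dense and }2\text{-separated additive subgroup }P\subseteq X\}$. *)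

(* Defs.v *)
From mathcomp Require Import all_boot all_order all_algebra.
From mathcomp Require Import all_classical all_reals all_analysis.

Set Implicit Arguments.
Unset Strict Implicit.
Unset Printing Implicit Defensive.

Import Order.TTheory GRing.Theory Num.Theory.
Import numFieldNormedType.Exports.

Local Open Scope classical_set_scope.
Local Open Scope card_scope.
Local Open Scope ring_scope.

(* Cardinals are represented by sets (of any type), compared with [#<=] and
   [#=]; in particular omega is [[set: nat]]. *)
Definition card_lt (T U : Type) (A : set T) (B : set U) : Prop :=
  A #<= B /\ ~ (B #<= A).

Definition linear_subspace (R : realType) (X : normedModType R)
  (Z : set X) : Prop := submod_closed (mem Z).

Definition additive_subgroup (R : realType) (X : normedModType R)
  (P : set X) : Prop := zmod_closed (mem P).

Definition linear_span (R : realType) (X : normedModType R)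
  (D : set X) : set X := smallest (@linear_subspace R X) D.

(* For a subspace [Z], [linear_span D] is contained in [Z], so its closure
   relative to [Z] is all of [Z] iff [Z] lies in its closure in [X]. *)
Definition spans_densely (R : realType) (X : normedModType R)
  (Z D : set X) : Prop := D `<=` Z /\ Z `<=` closure (linear_span D).

(* dens(Z) is the cardinality of K *)
Definition has_dens (R : realType) (X : normedModType R) (Z : set X)
    (T : Type) (K : set T) : Prop :=
  (exists2 D : set X, spans_densely Z D & D #= K) /\
  (forall D : set X, spans_densely Z D -> K #<= D).

(* dens(Z) < |K|; the cardinal dens(Z) is represented by a subset of X *)
Definition dens_lt (R : realType) (X : normedModType R) (Z : set X)
    (T : Type) (K : set T) : Prop :=
  exists2 D : set X, has_dens Z D & card_lt D K.

(* (< |K|)-octahedral *)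
Definition lt_octahedral (R : realType) (T : Type) (K : set T)
    (X : normedModType R) : Prop :=
  forall Z : set X, linear_subspace Z -> dens_lt Z K ->
  forall e : R, 0 < e ->
  exists2 x : X, `|x| = 1 &
    forall (z : X) (l : R), Z z -> (1 - e) * (`|z| + `|l|) <= `|z + l *: x|.

Definition octahedral (R : realType) (X : normedModType R) : Prop :=
  lt_octahedral [set: nat] X.

Definition separable (R : realType) (X : normedModType R) : Prop :=
  exists2 D : set X, countable D & dense D.

Definition r_separated (R : realType) (X : normedModType R) (r : R)
  (P : set X) : Prop := forall x y : X, P x -> P y -> x <> y -> r <= `|x - y|.

Definition r_dense (R : realType) (X : normedModType R) (r : R)
  (P : set X) : Prop := forall x : X, exists2 p : X, P p & `|x - p| <= r.

(* The infimum is taken in [\bar R], so that it is +oo, not 0, when no radius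
   is admissible. *)
Definition gamma_star (R : realType) (X : normedModType R) : \bar R :=
  ereal_inf [set r%:E | r in [set r : R | 0 < r /\
    exists P : set X,
      [/\ additive_subgroup P, r_dense r P & r_separated 2 P]]].

(* Main.v *)
Require Import Defs.
From mathcomp Require Import all_boot all_order all_algebra.
From mathcomp Require Import all_classical all_reals all_analysis.
From mathcomp Require Import wochoice lra.
From Stdlib Require Wellfounded.Inverse_Image Wellfounded.Inclusion.

(** The lower bound on [gamma_star X] holds in every normed space with a unit
    vector [v]. If a [2]-separated set [P] were [r]-dense with [r < 1], walk
    along the line of [v] in steps of length [1 - r]: the points of [P] within
    [r] of two consecutive positions are at distance less than [2], so they
    coincide, and one point of [P] stays within [r] of an unbounded sequence
    ([separated_dense_ge1]).

    For the upper bound, fix [t > 1] and write [(1 - e) * t = 1]. A subgroup is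
    [2]-separated as soon as its nonzero elements have norm at least [2]. Given
    such a subgroup [P] and a point [x] farther than [t] from [P], octahedrality
    gives a unit vector [u] that is nearly in l1-sum position with respect to
    the span of [P] and [x]; adjoin the generator [x + t u], at distance [t]
    from [x]. The norm of [q + n (x + t u)] is at least
    [(1 - e) (|q + n x| + |n| t)]. For [|n| = 1] both terms in the sum are at
    least [t], because [x] is far from [P]; for [|n| >= 2] the second term alone
    is at least [2 t]. In either case the norm is at least
    [(1 - e) 2 t = 2] ([norm_ge2_extend]).

    This step is iterated transfinitely over a norm dense set of points [x]. At
    each stage octahedrality must be applied to a subspace of density less than
    [K], so the dense set is well ordered in such a way that no initial segment
    has cardinality [K] ([initial_well_order]); the subgroup of all generators
    is then within [t] of every point of the dense set
    ([separated_subgroup_near]), and so [r]-dense for each [r > t].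

    Cardinal arithmetic enters in three places. A set of cardinality [K] with
    dense span yields a dense set of cardinality at most [K], namely its
    rational combinations, because the words over an infinite set are no more
    numerous than its elements ([coding_infinite], [spanning_norm_dense]).
    The same fact serves to build the well-order. Finally the density of a
    subspace is an attained minimum of cardinals ([ex_card_min]), which makes
    it comparable with [K]. *)

Set Implicit Arguments.
Unset Strict Implicit.
Unset Printing Implicit Defensive.

Import Order.TTheory GRing.Theory Num.Theory.
Import numFieldNormedType.Exports.

Local Open Scope classical_set_scope.
Local Open Scope card_scope.
Local Open Scope ring_scope.

(** * Comparison of cardinals *)

Lemma card_le_injfun (T U : Type) (A : set T) (B : set U) (f : T -> U) :
  set_fun A B f -> set_inj A f -> A #<= B.
Proof.
move=> fAB finj; have [g] : $|{injfun A >-> B}| by apply/injfunPex; exists f.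
exact: inj_card_le g.
Qed.

Lemma card_le_ex_injfun (T : Type) (U : pointedType) (A : set T) (B : set U) :
  A #<= B -> exists2 f : T -> U, set_fun A B f & set_inj A f.
Proof. by move=> /pcard_leP/injfunPex. Qed.

(** Cardinals are well founded. A maximal set [S] of choice functions on [F]
    that pairwise differ at every member of [F] must exhaust some member [A]
    by evaluation, since otherwise a choice function with new values everywhere
    could be added. Evaluation at [B] then embeds [S], hence [A], in each [B].
*)
Lemma ex_card_min (T : pointedType) (F : set (set T)) : F !=set0 ->
  exists2 A, F A & forall B, F B -> A #<= B.
Proof.
move=> F0.
pose P (S : set (set T -> T)) := forall B, F B ->
  (forall f, S f -> B (f B)) /\
  (forall f g, S f -> S g -> f B = g B -> f = g).
have [|S [PS maxS]] := @Zorn_bigcup _ P.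
  move=> C CP totC B FB; split=> [f [S CS Sf]|f g [S CS Sf] [S' CS' Sg]].
    exact: (CP _ CS _ FB).1.
  have [SS'|S'S] := totC _ _ CS CS'.
    exact: (CP _ CS' _ FB).2 (SS' _ Sf) Sg.
  exact: (CP _ CS _ FB).2 Sf (S'S _ Sg).
have [A FA SA] : exists2 A, F A & A `<=` (fun f => f A) @` S.
  apply: contrapT => /forall2NP noA.
  have /choice[g gP] : forall B, exists x,
      F B -> B x /\ forall f, S f -> f B <> x.
    move=> B; have [FB|nFB] := pselect (F B); last by exists point.
    have [//|/existsNP[x /not_implyP[Bx nSx]]] := noA B.
    by exists x => _; split=> // f Sf fx; apply: nSx; exists f.
  apply: (maxS (S `|` [set g])).
    split; first exact: subsetUl.
    move=> /(_ g (or_intror erefl)) Sg; have [B FB] := F0.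
    exact: (gP B FB).2 Sg erefl.
  move=> B FB; have [Bg ng] := gP B FB; have [SB injS] := PS B FB.
  split=> [f [/SB//|->//]|f h [Sf|->] [Sh|->] //].
  - exact: injS.
  - by move=> /(ng _ Sf).
  - by move=> /esym/(ng _ Sh).
exists A => // B FB; have [SB injS] := PS B FB.
apply: card_le_trans (subset_card_le SA) _.
apply: card_le_trans (card_image_le _ _) _.
apply: (card_le_injfun (f := fun f => f B)) => [f /SB//|f g].
by rewrite !inE; exact: injS.
Qed.

Lemma card_le_total (T : pointedType) (A B : set T) : A #<= B \/ B #<= A.
Proof.
have [|C [->|->] CP] := @ex_card_min T [set A; B]; first by exists A; left.
- by left; apply: CP; right.
- by right; apply: CP; left.
Qed.

(** * Words over an infinite set *)

(** Empty words are left out so that the empty set has a coding; this makes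
    the empty chain harmless in the maximality argument below. *)
Definition words (T : eqType) (A : set T) : set (seq T) :=
  [set s | s != [::] /\ forall x, x \in s -> A x].

Definition coding (T : eqType) (A : set T) (f : seq T -> T) : Prop :=
  set_fun (words A) A f /\ set_inj (words A) f.

(** Restricting [f] to the words over [A] turns extension of codings into
    inclusion of graphs. *)
Definition coding_graph (T : eqType) (A : set T) (f : seq T -> T) :
  set (seq T * T) := [set p | words A p.1 /\ p.2 = f p.1].

Lemma sub_words (T : eqType) (A B : set T) : A `<=` B -> words A `<=` words B.
Proof. by move=> AB s [s0 sA]; split=> // x /sA/AB. Qed.

Lemma words1 (T : eqType) (A : set T) x : A x -> words A [:: x].
Proof. by move=> Ax; split=> // y; rewrite inE => /eqP->. Qed.

Lemma words2 (T : eqType) (A : set T) x y : A x -> A y -> words A [:: x; y].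
Proof. by move=> Ax Ay; split=> // z; rewrite !inE => /orP[]/eqP->. Qed.

Lemma words_map (T U : eqType) (A : set T) (B : set U) (f : T -> U) s :
  set_fun A B f -> words A s -> words B (map f s).
Proof.
move=> fAB [s0 sA]; split; first by case: s s0 {sA}.
by move=> _ /mapP[x /sA/fAB ? ->].
Qed.

Lemma words_map_inj (T U : eqType) (A : set T) (f : T -> U) s s' :
  set_inj A f -> words A s -> words A s' -> map f s = map f s' -> s = s'.
Proof.
move=> finj [_ +] [_]; elim: s s' => [|x s IH] [|x' s'] //= sA sA' [fx fs].
congr cons; first by apply: finj => //; rewrite inE;
  [apply: sA|apply: sA']; rewrite inE eqxx.
by apply: IH => // y ys; [apply: sA|apply: sA']; rewrite inE ys orbT.
Qed.

Lemma coding_graph_sub (T : eqType) (A B : set T) f g :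
  coding_graph A f `<=` coding_graph B g ->
  A `<=` B /\ {in words A, f =1 g}.
Proof.
move=> sub; split=> [x Ax|s].
  have [|[_ +] _] := sub ([:: x], f [:: x]); first by split=> //; exact: words1.
  by apply; rewrite inE.
by rewrite inE => As; have [|_ /= ->] := sub (s, f s).
Qed.

(** The starting point: a countable subset of [K] has a coding because the
    finite sequences of natural numbers are countable. *)
Lemma coding_nat (T : pointedType) (K : set T) : infinite_set K ->
  exists A f, [/\ A !=set0, A `<=` K & coding A f].
Proof.
move=> /infiniteP/card_le_ex_injfun[k kK kinj].
have /choice[k' k'P] : forall x, exists n, range k x -> x = k n.
  move=> x; have [[n _ <-]|nx] := pselect (range k x); first by exists n.
  by exists 0%N.
exists (range k), (fun s => k (pickle (map k' s))); split.
- by exists (k 0%N), 0%N.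
- by move=> _ [n _ <-]; exact: kK.
split=> [s _|s s']; first by exists (pickle (map k' s)).
rewrite !inE => -[_ sA] [_ sA'] /kinj; rewrite !inE => /(_ I I).
move=> /(pcan_inj pickleK) ss'.
have kE (u : seq T) : (forall x, x \in u -> range k x) ->
    map k (map k' u) = u.
  elim: u => //= x u IH uA; rewrite -k'P; last by apply: uA; rewrite inE eqxx.
  by rewrite IH // => y yu; apply: uA; rewrite inE yu orbT.
by rewrite -(kE s) // -(kE s') // ss'.
Qed.

(** Zorn's lemma applies because a word is finite: over the union of a chain
    of sets, it is already a word over one of them. *)
Lemma coding_maximal (T : pointedType) (K : set T) : exists A f,
  [/\ A `<=` K, coding A f & forall B g, B `<=` K -> coding B g ->
    A `<=` B -> {in words A, f =1 g} -> B = A].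
Proof.
pose good (A : set T) f := A `<=` K /\ coding A f.
pose P G := exists A f, good A f /\ G = coding_graph A f.
have [|G [[A [f [[AK Af] ->]]] maxG]] := @Zorn_bigcup _ P; last first.
  exists A, f; split=> // B g BK Bg AB fg.
  apply/seteqP; split=> // x Bx; apply: contrapT => nAx.
  apply: (maxG (coding_graph B g)); last by exists B, g.
  split=> [[s y] [/= As /= ->]|/coding_graph_sub[/(_ _ Bx)]//].
  by split; [exact: sub_words As|rewrite fg// inE].
move=> F FP totF.
pose mem A f := good A f /\ F (coding_graph A f).
pose A := [set x | exists B g, mem B g /\ B x].
pose U := \bigcup_(G in F) G.
pose f s := xget point [set y | U (s, y)].
have nested B g B' g' : mem B g -> mem B' g' ->
    (B `<=` B' /\ {in words B, g =1 g'}) \/ (B' `<=` B /\ {in words B', g' =1 g}).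
  move=> [_ FB] [_ FB'].
  by have [/coding_graph_sub|/coding_graph_sub] := totF _ _ FB FB'; [left|right].
have sA B g : mem B g -> B `<=` A by move=> memB x Bx; exists B, g.
have wordsA s : words A s -> exists B g, mem B g /\ words B s.
  move=> [+ +]; case: s => // x s _.
  elim: s x => [|y s IH] x sAx.
    have [|B [g [Bg Bx]]] := sAx x; first by rewrite inE.
    by exists B, g; split=> //; exact: words1.
  have [|B [g [Bg [_ Bs]]]] := IH y.
    by move=> z zs; apply: sAx; rewrite inE zs orbT.
  have [|B' [g' [B'g' B'x]]] := sAx x; first by rewrite inE eqxx.
  have [[BB' _]|[B'B _]] := nested _ _ _ _ Bg B'g'.
    exists B', g'; split=> //; split=> // z; rewrite inE => /orP[/eqP->//|/Bs].
    exact: BB'.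
  exists B, g; split=> //; split=> // z; rewrite inE => /orP[/eqP->|/Bs//].
  exact: B'B.
have fE B g s : mem B g -> words B s -> f s = g s.
  move=> Bg Bs; have Usg : U (s, g s) by exists (coding_graph B g); [case: Bg|].
  have : [set y | U (s, y)] (f s) by apply: xgetPex; exists (g s).
  move=> /= [G FG]; have [B' [g' [B'g' GE]]] := FP _ FG.
  rewrite GE => -[/= B's /= ->]; have mB' : mem B' g' by split=> //; rewrite -GE.
  have [[BB' gg']|[B'B gg']] := nested _ _ _ _ Bg mB'.
    by rewrite gg' ?inE.
  by rewrite gg' ?inE.
exists A, f; split.
  split; first by move=> x [B [g [[[BK _] _] /BK]]].
  split=> [s /wordsA[B [g [Bg Bs]]]|s s'].
    by rewrite (fE _ _ _ Bg)//; apply: (sA _ _ Bg); case: Bg => -[_ [+ _]] _; apply.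
  rewrite !inE => /wordsA[B [g [Bg Bs]]] /wordsA[B' [g' [B'g' B's]]].
  have [[BB' _]|[B'B _]] := nested _ _ _ _ Bg B'g'.
    have B's' : words B' s by exact: sub_words Bs.
    rewrite !(fE _ _ _ B'g')//; case: B'g' => -[_ [_ inj]] _.
    by apply: inj; rewrite inE.
  have Bs' : words B s' by exact: sub_words B's.
  rewrite !(fE _ _ _ Bg)//; case: Bg => -[_ [_ inj]] _.
  by apply: inj; rewrite inE.
apply/seteqP; split=> [[s y] [G FG]|[s y] [/= As /= ->]].
  have [B [g [Bg GE]]] := FP _ FG; rewrite GE => -[/= Bs /= ->].
  have mB : mem B g by split=> //; rewrite -GE.
  by split=> /=; [exact: sub_words (sA _ _ mB) _ Bs|rewrite (fE _ _ _ mB)].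
have [B [g [Bg Bs]]] := wordsA _ As.
by exists (coding_graph B g); [case: Bg|split=> //=; rewrite (fE _ _ _ Bg)].
Qed.

(** A set with a coding absorbs any set that embeds in it: tag the elements of
    [A] and the images of the elements of [B] with two distinct letters, and
    code the resulting two-letter words. *)
Lemma coding_absorb (T : pointedType) (A B : set T) f :
  coding A f -> A !=set0 -> A `&` B = set0 -> B #<= A ->
  exists2 c : T -> T, set_fun (A `|` B) A c & set_inj (A `|` B) c.
Proof.
move=> [fA finj] [a Aa] AB /card_le_ex_injfun[g gA ginj].
pose b := f [:: a; a]; pose a0 := f [:: a].
have Aa0 : A a0 by apply: fA; exact: words1.
have Ab : A b by apply: fA; exact: words2.
have a0b : a0 <> b.
  by move/finj; rewrite !inE => /(_ (words1 Aa) (words2 Aa Aa)).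
pose c x := if x \in A then f [:: a0; x] else f [:: b; g x].
have disj x : B x -> (x \in A) = false.
  move=> Bx; apply/negbTE/negP; rewrite inE => Ax.
  by have : (A `&` B) x by []; rewrite AB.
exists c => [x [Ax|Bx]|x y].
- by rewrite /c mem_set//; apply: fA; exact: words2.
- by rewrite /c disj//; apply: fA; apply: words2 => //; exact: gA.
have wA z : A z -> words A [:: a0; z] by move=> ?; exact: words2.
have wB z : B z -> words A [:: b; g z] by move=> ?; apply: words2 => //; exact: gA.
rewrite !inE /c => -[Ax|Bx] [Ay|By]; rewrite ?(mem_set Ax) ?(mem_set Ay) ?disj//.
- by move/finj; rewrite !inE => /(_ (wA _ Ax) (wA _ Ay)) [].
- by move/finj; rewrite !inE => /(_ (wA _ Ax) (wB _ By)) [].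
- by move/finj; rewrite !inE => /(_ (wB _ Bx) (wA _ Ay)) [/esym].
- move/finj; rewrite !inE => /(_ (wB _ Bx) (wB _ By)) [/ginj].
  by rewrite !inE; exact.
Qed.

(** An infinite set has as many words as elements. Take a maximal coding
    [A], [f] inside [K] and compare [A] with the rest of [K]. If the rest embeds
    in [A], then [A] absorbs it and words over [K] are coded through words over
    [A]. Otherwise a copy [B] of [A] lies outside [A]; words over [A] and [B]
    together are coded through [A] by absorption and sent into [B] when they
    are not words over [A], which contradicts maximality. *)
Lemma coding_infinite (T : pointedType) (K : set T) : infinite_set K ->
  exists f, coding K f.
Proof.
move=> Kinf; have [A [f [AK Af maxA]]] := coding_maximal K.
have A0 : A !=set0.
  apply/set0P/eqP => A0; have [B [g [B0 BK Bg]]] := coding_nat Kinf.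
  have BA : B = A.
    apply: (maxA _ g) => //; first by rewrite A0.
    move=> s; rewrite A0 inE => -[+ +]; case: s => // x s _ /(_ x).
    by rewrite inE eqxx => /(_ isT).
  by move/set0P/eqP: B0; rewrite BA A0.
have AC : A `&` (K `\` A) = set0 by apply/seteqP; split=> // x [Ax []].
have [AleC|CleA] := card_le_total A (K `\` A); last first.
  have [c cA cinj] := coding_absorb Af A0 AC CleA.
  move: cA cinj; rewrite setDUK // => cA cinj.
  exists (f \o map c); case: Af => fA finj; split=> [s Ks|s s'].
    by apply: AK; apply: fA; exact: words_map Ks.
  rewrite !inE => Ks Ks' /= /finj; rewrite !inE.
  move=> /(_ (words_map cA Ks) (words_map cA Ks')).
  exact: words_map_inj Ks Ks'.
have [h hC hinj] := card_le_ex_injfun AleC.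
pose B := h @` A.
have BC : B `<=` K `\` A by move=> _ [x Ax <-]; exact: hC.
have AB : A `&` B = set0.
  by apply/seteqP; split=> // x [Ax /BC[]].
have [c cA cinj] := coding_absorb Af A0 AB (card_image_le _ _).
case: (Af) => fA finj.
pose F s := if s \in words A then f s else h (f (map c s)).
have FA s : words A s -> F s = f s by move=> As; rewrite /F mem_set.
suff BA : A `|` B = A.
  have [a Aa] := A0; have [|_] := BC (h a); first by exists a.
  by case; rewrite -BA; right; exists a.
apply: (maxA _ F) => //.
- by move=> x [/AK//|/BC[]].
- have wc s : words (A `|` B) s -> words A (map c s) by exact: words_map.
  split=> [s ABs|s s'].
    rewrite /F; case: ifPn => [|_]; first by rewrite inE => As; left; exact: fA.
    by right; exists (f (map c s)) => //; apply: fA; exact: wc.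
  rewrite !inE => ABs ABs'.
  have fcA u : words (A `|` B) u -> A (f (map c u)) by move=> ?; apply/fA/wc.
  have fh u v : words A u -> words (A `|` B) v -> f u = h (f (map c v)) -> False.
    move=> Au ABv E; have [_] := hC _ (fcA _ ABv).
    by apply; rewrite -E; exact: fA.
  rewrite /F; case: ifPn => [|_]; case: ifPn => [|_]; rewrite ?inE.
  + by move=> As' As; apply: finj; rewrite inE.
  + by move=> As /(fh _ _ As ABs').
  + by move=> As' /esym/(fh _ _ As' ABs).
  + move/hinj; rewrite !inE => /(_ (fcA _ ABs) (fcA _ ABs')) /finj.
    rewrite !inE => /(_ (wc _ ABs) (wc _ ABs')).
    exact: words_map_inj ABs ABs'.
- by move=> s; rewrite inE => /FA.
Qed.

(** The codes of one-letter words and of doubled letters form two disjoint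
    copies of [S] in [S], and one of them misses a given point. *)
Lemma card_le_setD1 (T : pointedType) (S : set T) a : infinite_set S ->
  S #<= S `\ a.
Proof.
move=> /coding_infinite[f [fS finj]].
have w x : S x -> words S [:: x] by exact: words1.
have w2 x : S x -> words S [:: x; x] by move=> ?; exact: words2.
have [[b [Sb ba]]|nb] := pselect (exists b, S b /\ f [:: b] = a); last first.
  apply: (card_le_injfun (f := fun x => f [:: x])) => [x Sx|x y].
    by split; [apply/fS/w|move=> xa; apply: nb; exists x].
  by rewrite !inE => Sx Sy /finj; rewrite !inE => /(_ (w _ Sx) (w _ Sy)) [].
apply: (card_le_injfun (f := fun x => f [:: x; x])) => [x Sx|x y].
  split; first by apply/fS/w2.
  by rewrite /= -ba => /finj; rewrite !inE => /(_ (w2 _ Sx) (w _ Sb)).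
by rewrite !inE => Sx Sy /finj; rewrite !inE => /(_ (w2 _ Sx) (w2 _ Sy)) [].
Qed.

(** * Well-orders with small initial segments *)

Definition strict (T : Type) (R : rel T) (x y : T) : Prop := ~~ R y x.

(** If some closed segment of a well-order of [A] has cardinality at least [K],
    let [a] be the least end of such a segment. The segment still dominates [A]
    after [a] is removed, and pulling the order back along an embedding of [A]
    in what remains leaves only segments ending before [a]. The pullback is
    antisymmetric on [A] only, since the embedding is injective only there. *)
Lemma initial_well_order (T : pointedType) (U : Type) (A : set T) (K : set U) :
  infinite_set K -> A #<= K -> exists R : rel T,
  [/\ total R, transitive R, {in A &, antisymmetric R}, well_founded (strict R)
    & forall a, A a -> ~ (K #<= [set b | A b /\ R b a])].
Proof.
move=> Kinf AK; have [R woR] := well_ordering_principle T.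
have woT : wo_chain R predT by move=> B _; exact: woR.
have Rtot : total R by move=> x y; exact: (wo_chainW woT).
have Ranti : antisymmetric R.
  by move=> x y; exact: (wo_chain_antisymmetric woT).
have Rmin (B : set T) : B !=set0 -> exists2 z, B z & forall x, B x -> R z x.
  move=> [x Bx]; have [|z [[Bz zmin] _]] := woR (mem B).
    by exists x; rewrite inE.
  by exists z; [rewrite inE in Bz|move=> y By; apply: zmin; rewrite inE].
have Rtrans : transitive R.
  move=> y x z Rxy Ryz.
  have [|m [[->|->]|->] mP] := Rmin [set x; y; z]; first by exists x; left; left.
  - by apply: mP; right.
  - have <- // : y = x.
    by apply: Ranti; rewrite Rxy mP//; left; left.
  - have <- // : y = z.
    by apply: Ranti; rewrite Ryz mP//; left; right.
have Rwf : well_founded (strict R).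
  apply: contrapT => /existsNP[x nAcc].
  have [|m nm mP] := Rmin [set x | ~ Acc (strict R) x]; first by exists x.
  apply: nm; constructor=> y; rewrite /strict => nRmy.
  by apply: contrapT => /mP; apply/negP.
have [segA|] := pselect (forall a, A a -> ~ (K #<= [set b | A b /\ R b a])).
  by exists R; split=> // x y _ _; exact: Ranti.
move=> /existsNP[a0 /not_implyP[Aa0 /contrapT segKa0]].
have [|a [Aa segKa] amin] :=
  Rmin [set a | A a /\ K #<= [set b | A b /\ R b a]]; first by exists a0.
have seginf : infinite_set [set b | A b /\ R b a].
  by apply/infiniteP/(card_le_trans _ segKa)/infiniteP.
have := card_le_trans AK (card_le_trans segKa (card_le_setD1 a seginf)).
move=> /card_le_ex_injfun[f fseg finj].
exists (fun x y => R (f x) (f y)); split.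
- by move=> x y; exact: Rtot.
- by move=> y x z; exact: Rtrans.
- by move=> x y Ax Ay /Ranti; exact: finj.
- exact: (Inverse_Image.wf_inverse_image _ _ (strict R) f Rwf).
move=> x Ax /card_le_trans; have [[Afx Rfxa] fxa] := fseg _ Ax.
move=> /(_ _ [set c | A c /\ R c (f x)]) Kle.
have : R a (f x).
  apply: amin; split=> //; apply: Kle.
  apply: (card_le_injfun (f := f)) => [b [Ab Rb]|b b'].
    by split=> //; case: (fseg _ Ab) => -[].
  by rewrite !inE => -[Ab _] [Ab' _]; apply: finj; rewrite inE.
by move=> Rafx; apply: fxa; apply: Ranti; rewrite Rafx Rfxa.
Qed.

(** Well-founded recursion for steps that depend only on the set of the earlier
    values. *)
Lemma wf_recursion (T U : Type) (lt : T -> T -> Prop) (step : set U -> T -> U) :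
  well_founded lt ->
  exists y : T -> U, forall i, y i = step (y @` [set j | lt j i]) i.
Proof.
move=> ltwf.
pose F i (rec : forall j, lt j i -> U) :=
  step [set v | exists j (h : lt j i), v = rec j h] i.
exists (Fix ltwf (fun=> U) F) => i; rewrite Fix_eq.
  congr step; apply/seteqP; split=> [_ [j [h ->]]|_ [j h <-]].
    by exists j.
  by exists j, h.
move=> {}i f g fg; congr step; apply/seteqP.
by split=> _ [j [h ->]]; exists j, h; rewrite fg.
Qed.

(** * Subgroups, subspaces and separation *)

Lemma additive_subgroupP (R : realType) (X : normedModType R) (P : set X) :
  additive_subgroup P <-> P 0 /\ forall x y, P x -> P y -> P (x - y).
Proof.
split=> [[P0 PB]|[P0 PB]]; split.
- by rewrite inE in P0.
- by move=> x y Px Py; have := PB x y; rewrite !inE; exact.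
- by rewrite inE.
- by move=> x y; rewrite !inE; exact: PB.
Qed.

Lemma linear_subspaceP (R : realType) (X : normedModType R) (Z : set X) :
  linear_subspace Z <-> Z 0 /\ forall a x y, Z x -> Z y -> Z (a *: x + y).
Proof.
split=> [[Z0 ZD]|[Z0 ZD]]; split.
- by rewrite inE in Z0.
- by move=> a x y Zx Zy; have := ZD a x y; rewrite !inE; exact.
- by rewrite inE.
- by move=> a x y; rewrite !inE; exact: ZD.
Qed.

Lemma linear_subspace_subgroup (R : realType) (X : normedModType R)
    (Z : set X) :
  linear_subspace Z -> additive_subgroup Z.
Proof.
move=> /linear_subspaceP[Z0 ZD]; apply/additive_subgroupP; split=> // x y Zx Zy.
by rewrite addrC -scaleN1r; exact: ZD.
Qed.

Definition generated_subgroup (R : realType) (X : normedModType R)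
    (D : set X) : set X :=
  smallest (@additive_subgroup R X) D.

Lemma generated_subgroupP (R : realType) (X : normedModType R) (D : set X) :
  additive_subgroup (generated_subgroup D).
Proof.
apply/additive_subgroupP; split=> [P [/additive_subgroupP[]]//|x y Dx Dy P PD].
have [/additive_subgroupP[_ PB] _] := PD.
by apply: PB; [exact: Dx|exact: Dy].
Qed.

Lemma linear_spanP (R : realType) (X : normedModType R) (D : set X) :
  linear_subspace (linear_span D).
Proof.
apply/linear_subspaceP; split=> [P [/linear_subspaceP[]]//|a x y Dx Dy P PD].
have [/linear_subspaceP[_ ZD] _] := PD.
by apply: ZD; [exact: Dx|exact: Dy].
Qed.

Lemma generated_subgroupS (R : realType) (X : normedModType R) (D E : set X) :
  D `<=` generated_subgroup E -> generated_subgroup D `<=` generated_subgroup E.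
Proof. by apply: smallest_sub; exact: generated_subgroupP. Qed.

(** The spanning set need not realize the density of its span, so a set of
    least cardinality with dense span is chosen. *)
Lemma dens_lt_linear_span (R : realType) (X : normedModType R) (T : Type)
    (K : set T) (D : set X) :
  D #<= K -> ~ (K #<= D) -> dens_lt (linear_span D) K.
Proof.
move=> DK nKD.
have spanD : spans_densely (linear_span D) D.
  by split; [exact: sub_gen_smallest|exact: subset_closure].
have [|D' D'span D'min] :=
  @ex_card_min X [set D' | spans_densely (linear_span D) D'].
  by exists D.
have D'D : D' #<= D by exact: D'min.
exists D'; first by split=> //; exists D' => //; exact: card_eqxx.
split; first exact: card_le_trans DK.
by move=> KD'; apply: nKD; exact: card_le_trans D'D.
Qed.

Definition norm_ge2 (R : realType) (X : normedModType R) (P : set X) : Prop :=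
  forall p, P p -> p <> 0 -> 2 <= `|p|.

Lemma norm_ge2_separated (R : realType) (X : normedModType R) (P : set X) :
  additive_subgroup P -> norm_ge2 P -> r_separated 2 P.
Proof.
move=> /additive_subgroupP[_ PB] P2 x y Px Py xy; apply: P2; first exact: PB.
by move/eqP; rewrite subr_eq0 => /eqP.
Qed.

(** The vectors that octahedrality provides for the subspace [Z]. *)
Definition octahedral_direction (R : realType) (X : normedModType R) (e : R)
    (Z : set X) (u : X) : Prop :=
  `|u| = 1 /\
  forall z (l : R), Z z -> (1 - e) * (`|z| + `|l|) <= `|z + l *: u|.

(** The successor step: [x + t u] is a new generator near [x] that keeps the
    nonzero elements of the subgroup at norm at least [2]. *)
Lemma norm_ge2_extend (R : realType) (X : normedModType R) (P Z : set X)
    (x u : X) (e t : R) :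
  0 < t -> (1 - e) * t = 1 -> additive_subgroup P -> norm_ge2 P ->
  linear_subspace Z -> P `<=` Z -> Z x ->
  octahedral_direction e Z u ->
  (forall q, P q -> t < `|x - q|) ->
  norm_ge2 (generated_subgroup (P `|` [set x + t *: u])).
Proof.
move=> t0 et Psub P2 Zlin PZ Zx [_ oct] far.
have /additive_subgroupP[P0 PB] := Psub.
have e1 : 0 < 1 - e by rewrite -(pmulr_lgt0 _ t0) et.
pose y := x + t *: u.
pose Q := [set v | exists q (n : int), P q /\ v = q + y *~ n].
have Qsub : additive_subgroup Q.
  apply/additive_subgroupP; split; first by exists 0, 0; rewrite mulr0z addr0.
  move=> _ _ [q [n [Pq ->]]] [q' [n' [Pq' ->]]].
  exists (q - q'), (n - n'); split; first exact: PB.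
  by rewrite mulrzBr opprD addrACA.
suff Q2 : norm_ge2 Q.
  move=> v vP; apply: Q2; move: v vP; apply: smallest_sub => // v [Pv|->].
    by exists v, 0; rewrite mulr0z addr0.
  by exists 0, 1; rewrite add0r mulr1z.
move=> _ [q [n [Pq ->]]].
have [->|n0] := eqVneq n 0; first by rewrite mulr0z addr0; exact: P2.
move=> _; have -> : q + y *~ n = (q + n%:~R *: x) + (n%:~R * t) *: u.
  by rewrite -scaler_int scalerDr scalerA addrA.
have Zq : Z (q + n%:~R *: x).
  move/linear_subspaceP: Zlin => [_ ZD].
  by rewrite addrC; apply: ZD => //; exact: PZ.
apply: le_trans (oct _ (n%:~R * t) Zq).
rewrite normrM (gtr0_norm t0) -intr_norm.
have -> : 2 = (1 - e) * (t + t) by rewrite mulrDr et.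
rewrite ler_pM2l//.
have [n2|n2] := leP 2 `|n|.
  apply: le_trans (_ : `|n|%:~R * t <= _); last by rewrite lerDr.
  by rewrite -mulr2n -mulr_natl ler_pM2r// (ler_int _ 2).
(* what remains is [n = 1] or [n = -1], where the distance from [x] is used *)
have n1 : `|n| = 1 by apply/eqP; rewrite eq_le -ltzD1 n2 -gtz0_ge1 normr_gt0.
rewrite n1 mul1r lerD2r ltW//.
have [n_ge0|n_lt0] := leP 0 n.
  move: n1; rewrite ger0_norm// => ->; rewrite scale1r addrC -[q]opprK.
  by apply: far; rewrite -sub0r; exact: PB.
move: n1; rewrite ltr0_norm// => /(congr1 -%R); rewrite opprK => ->.
by rewrite scaleN1r distrC; exact: far.
Qed.

(** * Transfinite construction of the subgroup *)

Lemma octahedral_direction_exists (R : realType) (X : normedModType R)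
    (T : Type) (K : set T) (D S : set X) (e : R) :
  lt_octahedral K X -> 0 < e -> S #<= K -> ~ (K #<= S) -> D #<= S ->
  exists u : X, octahedral_direction e (linear_span D) u.
Proof.
move=> Xoct e0 SK nKS DS.
have [|u u1 uP] := Xoct (linear_span D) (linear_spanP D) _ e e0.
  apply: dens_lt_linear_span; first exact: card_le_trans SK.
  by move=> KD; apply: nKS; exact: card_le_trans DS.
by exists u.
Qed.

(** When [x] is already within [t] of the subgroup generated by [Y], the value
    [0] stands for no new generator. *)
Definition add_generator (R : realType) (X : normedModType R) (e t : R)
    (Y : set X) (x : X) : X :=
  if `[< exists2 q, generated_subgroup Y q & `|x - q| <= t >] then 0
  else x + t *: xget 0 (octahedral_direction e (linear_span (Y `|` [set x]))).

(** An element involves finitely many generators, hence a last one. *)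
Lemma generated_subgroup_directed (R : realType) (X : normedModType R)
    (I : Type) (le : rel I) (S : set I) (y : I -> X) :
  total le -> transitive le ->
  generated_subgroup (y @` S) `<=`
    [set p | p = 0 \/ exists2 i, S i &
      generated_subgroup (y @` [set j | S j /\ le j i]) p].
Proof.
move=> letot letrans.
pose G i := generated_subgroup (y @` [set j | S j /\ le j i]).
have GB i p q : G i p -> G i q -> G i (p - q).
  have /additive_subgroupP[_ +] := generated_subgroupP (y @` [set j | S j /\ le j i]).
  exact.
have GS i j : le i j -> G i `<=` G j.
  move=> ij; apply: generated_subgroupS => _ [k [Sk ki] <-].
  by apply: sub_gen_smallest; exists k => //; split=> //; exact: letrans ij.
apply: smallest_sub; last first.
  move=> _ [i Si <-]; right; exists i => //; apply: sub_gen_smallest.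
  by exists i => //; split=> //; rewrite -[le i i]orbb letot.
apply/additive_subgroupP; split; first by left.
move=> p q [->|[i Si ip]] [->|[j Sj jq]].
- by left; rewrite subr0.
- by right; exists j => //; apply: (@GB j) => //; rewrite -(subrr q); exact: (@GB j).
- by right; exists i => //; rewrite subr0.
- right; have [ij|ji] := orP (letot i j).
    by exists j => //; apply: (@GB j) => //; exact: GS ij _ _.
  by exists i => //; apply: (@GB i) => //; exact: GS ji _ _.
Qed.

(** The generators [y i], for [i] in [A], are defined by recursion along a
    well-order of [A] with small segments. At stage [i] the relevant subspace is
    spanned by [i] and the earlier generators, a family indexed by the closed
    segment [upto i], so octahedrality applies. Separation of the subgroup
    generated up to [i] follows by well-founded induction: the subgroup
    generated before [i] is a directed union of earlier ones, and the passage
    from it to stage [i] is [norm_ge2_extend]. *)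
Lemma separated_subgroup_near (R : realType) (X : normedModType R) (T : Type)
    (K : set T) (A : set X) (e t : R) :
  infinite_set K -> lt_octahedral K X ->
  0 < e -> 0 < t -> (1 - e) * t = 1 -> A #<= K ->
  exists P : set X, [/\ additive_subgroup P, norm_ge2 P &
    forall x, A x -> exists2 p, P p & `|x - p| <= t].
Proof.
move=> Kinf Xoct e0 t0 et AK.
have [le [letot letrans leanti lewf leK]] := initial_well_order Kinf AK.
pose lt j i := A j /\ strict le j i.
have ltwf : well_founded lt.
  by apply: Inclusion.wf_incl lewf => j i [].
have [y yE] := wf_recursion (add_generator e t) ltwf.
pose before i := [set j | lt j i].
pose upto i := [set j | A j /\ le j i].
have ltle j i : lt j i -> A j /\ le j i.
  move=> [Aj]; rewrite /strict => nij; split=> //.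
  by have := letot j i; rewrite (negbTE nij) orbF.
have uptoE i : A i -> upto i = before i `|` [set i].
  move=> Ai; apply/seteqP; split=> j; last first.
    by move=> [/ltle//|->]; split=> //; rewrite -[le i i]orbb letot.
  move=> [Aj ji]; have [ij|nij] := boolP (le i j); last by left.
  by right; apply: leanti; rewrite ?inE// ji ij.
have sepB i : (forall j, lt j i -> norm_ge2 (generated_subgroup (y @` upto j))) ->
    norm_ge2 (generated_subgroup (y @` before i)).
  move=> IH p /(generated_subgroup_directed letot letrans)[//|[j ltj jp]].
  apply: (IH j ltj); apply: generated_subgroupS p jp => _ [k [[Ak _] kj] <-].
  by apply: sub_gen_smallest; exists k.
pose near i := exists2 q, generated_subgroup (y @` before i) q & `|i - q| <= t.
have far i : A i -> ~ near i -> exists2 u, y i = i + t *: u &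
    octahedral_direction e (linear_span (y @` before i `|` [set i])) u.
  move=> Ai nnear.
  exists (xget 0 (octahedral_direction e (linear_span (y @` before i `|` [set i])))).
    by rewrite yE /add_generator; case: asboolP.
  apply: xgetPex; apply: (octahedral_direction_exists (S := upto i) Xoct) => //.
  - by apply: card_le_trans AK; apply: subset_card_le => j [].
  - exact: leK.
  (* [i] itself takes the place of the generator of index [i], so that the
     family is an image of the segment *)
  pose h j := if j == i then i else y j.
  apply: card_le_trans (card_image_le h _); apply: subset_card_le.
  move=> _ [[j ltj <-]|->]; last first.
    by exists i; [rewrite uptoE//; right|rewrite /h eqxx].
  exists j; first exact: ltle.
  rewrite /h; case: eqP => // ji; move: ltj; rewrite ji => -[_].
  by rewrite /strict -[le i i]orbb letot.
have sep i : A i -> norm_ge2 (generated_subgroup (y @` upto i)).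
  elim/(well_founded_ind ltwf) : i => i IH Ai.
  have {IH}sepi := sepB _ (fun j ltj => IH j ltj (proj1 ltj)).
  have [nearj|nnear] := pselect (near i).
    move=> p pP; apply: sepi; move: p pP; apply: generated_subgroupS.
    rewrite uptoE// => _ [j [ltj|->] <-].
      by apply: sub_gen_smallest; exists j.
    rewrite yE /add_generator; case: asboolP => // _.
    by have /additive_subgroupP[] := generated_subgroupP (y @` before i).
  have [u yu uP] := far _ Ai nnear.
  have Zlin := linear_spanP (y @` before i `|` [set i]).
  have : norm_ge2 (generated_subgroup
      (generated_subgroup (y @` before i) `|` [set i + t *: u])).
    apply: (norm_ge2_extend t0 et _ sepi Zlin) uP _.
    - exact: generated_subgroupP.
    - apply: smallest_sub; first exact: linear_subspace_subgroup.
      by move=> v yv; apply: sub_gen_smallest; left.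
    - by apply: sub_gen_smallest; right.
    - by move=> q qP; rewrite ltNge; apply/negP => ?; apply: nnear; exists q.
  move=> sepi' p pP; apply: sepi'; move: p pP; apply: generated_subgroupS.
  rewrite uptoE// => _ [j [ltj|->] <-]; apply: sub_gen_smallest; last by right.
  by left; apply: sub_gen_smallest; exists j.
exists (generated_subgroup (y @` A)); split.
- exact: generated_subgroupP.
- by move=> p /(generated_subgroup_directed letot letrans)[//|[j Aj]]; exact: sep.
- move=> x Ax; have [[q qP xq]|/(far _ Ax)[u yu [u1 _]]] := pselect (near x).
    exists q => //; apply: generated_subgroupS qP => _ [j [Aj _] <-].
    by apply: sub_gen_smallest; exists j.
  exists (y x); first by apply: sub_gen_smallest; exists x.
  by rewrite yu opprD addNKr normrN normrZ u1 mulr1 gtr0_norm.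
Qed.

(** * The value of the packing-covering constant *)

Lemma separated_dense_ge1 (R : realType) (X : normedModType R) (v : X)
    (P : set X) (r : R) : `|v| = 1 -> r_dense r P -> r_separated 2 P -> 1 <= r.
Proof.
move=> v1 dP sP; rewrite leNgt; apply/negP => r1.
have [p0 Pp0 p0r] := dP 0; rewrite sub0r normrN in p0r.
have near n : `|n%:R * (1 - r) *: v - p0| <= r.
  elim: n => [|n IH]; first by rewrite mul0r scale0r sub0r normrN.
  have [p Pp pr] := dP (n.+1%:R * (1 - r) *: v).
  suff <- : p = p0 by [].
  apply: contrapT => /(sP _ _ Pp Pp0); apply/negP; rewrite -ltNge.
  have -> : p - p0 = (1 - r) *: v - (n.+1%:R * (1 - r) *: v - p)
      + (n%:R * (1 - r) *: v - p0).
    rewrite -natr1 mulrDl mul1r (scalerDl v (n%:R * _)) opprB opprD.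
    by rewrite [(1 - r) *: v + _]addrC -!addrA addKr addKr .
  apply: le_lt_trans (ler_normD _ _) _; apply: le_lt_trans (_ : _ <= 1 - r + r + r) _.
    by apply: lerD IH; apply: le_trans (ler_normB _ _) _; apply: lerD pr;
      rewrite normrZ v1 mulr1 gtr0_norm ?subr_gt0.
  by rewrite subrK ltrD2l.
have r1' : 0 < 1 - r by rewrite subr_gt0.
have := archi_boundP (ltW (divr_gt0 (ltr0Sn R 1) r1')).
set n := Num.bound _ => nP.
have : n%:R * (1 - r) <= r + r.
  have -> : n%:R * (1 - r) = `|n%:R * (1 - r) *: v|.
    by rewrite normrZ v1 mulr1 ger0_norm// mulr_ge0// ltW.
  rewrite -[X in `|X|](subrK p0); apply: le_trans (ler_normD _ _) _.
  exact: lerD.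
apply/negP; rewrite -ltNge; apply: (@lt_trans _ _ 2); first by lra.
by rewrite -ltr_pdivrMr.
Qed.

Definition norm_dense (R : realType) (X : normedModType R) (E : set X) : Prop :=
  forall x (e : R), 0 < e -> exists2 a, E a & `|x - a| < e.

Lemma closure_norm (R : realType) (X : normedModType R) (E : set X) (x : X)
    (e : R) :
  closure E x -> 0 < e -> exists2 a, E a & `|x - a| < e.
Proof.
move=> Ex e0; have [a [Ea]] := Ex _ (nbhsx_ballx x e e0).
by rewrite -ball_normE /= => xa; exists a.
Qed.

(** Stated for a dense set of cardinality at most [K]: this covers the separable
    case too, where the density may a priori be finite. *)
Lemma gamma_star_eq1 (R : realType) (X : normedModType R) (T : Type) (K : set T)
    (E : set X) : infinite_set K -> lt_octahedral K X -> norm_dense E ->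
  E #<= K -> gamma_star X = 1%E.
Proof.
move=> Kinf Xoct Ed EK; apply/eqP; rewrite eq_le; apply/andP; split.
  apply/lee_addgt0Pr => d d0.
  have d20 : 0 < d / 2 by rewrite divr_gt0.
  pose t := 1 + d / 2.
  have t1 : 1 < t by rewrite ltrDl.
  have t0 : 0 < t by exact: lt_trans t1.
  (* [t] lies strictly between [1] and the target radius [1 + d]; the gap is
     spent on approximating points by elements of [E] *)
  have [|||P [Psub P2 Pt]] :=
    separated_subgroup_near (e := 1 - t^-1) (t := t) Kinf Xoct _ _ _ EK.
  - by rewrite subr_gt0 invf_lt1.
  - by [].
  - by rewrite opprB addrC subrK mulVf// gt_eqF.
  apply: ereal_inf_lbound; exists (1 + d); last by rewrite EFinD.
  split; first by rewrite addr_gt0.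
  exists P; split=> //; last exact: norm_ge2_separated.
  move=> x; have [a Ea xa] := Ed x _ d20; have [p Pp ap] := Pt _ Ea.
  exists p => //; rewrite -(subrKA a); apply: le_trans (ler_normD _ _) _.
  have -> : 1 + d = d / 2 + t by rewrite /t; lra.
  by apply: lerD ap; exact: ltW.
apply: le_ereal_inf_tmp => _ [r [r0 [P [_ dP sP]]] <-].
(* octahedrality for the zero subspace provides a unit vector *)
have [|v v1 _] := Xoct _ (linear_spanP set0) _ 1 ltr01.
  apply: dens_lt_linear_span; first exact: card_ge0.
  by rewrite card_le0 => /eqP K0; apply: Kinf; rewrite K0.
by rewrite lee_fin; exact: separated_dense_ge1 v1 dP sP.
Qed.

(** The rational combinations of [D] are dense. Each is encoded by a word of
    words over [D]: the first letter of an inner word is the vector, and its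
    length encodes the rational coefficient. Coding twice bounds their number by
    the cardinality of [D]. *)
Lemma spanning_norm_dense (R : realType) (X : normedModType R) (D : set X) :
  infinite_set D -> spans_densely [set: X] D ->
  exists2 E : set X, norm_dense E & E #<= D.
Proof.
move=> Dinf [_ Dspan].
have [f [fD finj]] := coding_infinite Dinf.
have [d0 Dd0] := infinite_setN0 Dinf.
pose term (w : seq X) : X :=
  ratr (odflt 0 (unpickle (size w).-1) : rat) *: head 0 w.
pose val (L : seq (seq X)) : X := \sum_(w <- L) term w.
pose E := val @` words (words D).
have ratE (q : rat) d : D d -> E (ratr q *: d).
  move=> Dd; exists [:: nseq (pickle q).+1 d].
    apply: words1; split=> // x; rewrite mem_nseq => /andP[_ /eqP->//].
  by rewrite /val big_seq1 /term size_nseq /= pickleK.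
have ED x y : E x -> E y -> E (x + y).
  move=> [L [L0 LD] <-] [L' [_ L'D] <-]; exists (L ++ L').
    split; first by case: (L) L0.
    by move=> w; rewrite mem_cat => /orP[/LD|/L'D].
  by rewrite /val big_cat.
exists E; last first.
  apply: card_le_trans (card_image_le _ _) _.
  apply: (card_le_injfun (f := f \o map f)) => [L /(words_map fD)/fD//|L L'].
  rewrite !inE => wL wL' /= /finj; rewrite !inE.
  move=> /(_ (words_map fD wL) (words_map fD wL')).
  exact: words_map_inj wL wL'.
pose C : set X :=
  [set x | forall e : R, 0 < e -> exists2 a, E a & `|x - a| < e].
have CD x y : C x -> C y -> C (x + y).
  move=> Cx Cy e e0; have e20 : 0 < e / 2 by rewrite divr_gt0.
  have [a Ea xa] := Cx _ e20; have [b Eb yb] := Cy _ e20.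
  exists (a + b); first exact: ED.
  rewrite opprD addrACA (splitr e); apply: le_lt_trans (ler_normD _ _) _.
  exact: ltrD.
have C0 : C 0.
  move=> e e0; exists 0; last by rewrite subrr normr0.
  by rewrite -(scale0r d0) -(rmorph0 ratr); exact: ratE.
(* [C] is closed under sums but only rational multiples come for free; [S] is
   the largest part of it that is stable under real scaling *)
pose S := [set x | forall l : R, C (l *: x)].
have spanS : linear_span D `<=` S.
  apply: smallest_sub.
    apply/linear_subspaceP; split=> [l|a x y Sx Sy l]; first by rewrite scaler0.
    by rewrite scalerDr scalerA; exact: CD.
  move=> d Dd l e e0.
  have d1 : 0 < `|d| + 1 by rewrite ltr_wpDl.
  have ed : 0 < e / (`|d| + 1) by rewrite divr_gt0.
  have [|q] := @rat_in_itvoo _ l (l + e / (`|d| + 1)); first by rewrite ltrDl.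
  rewrite in_itv /= => /andP[lq ql]; exists (ratr q *: d); first exact: ratE.
  rewrite -scalerBl normrZ distrC gtr0_norm ?subr_gt0//.
  apply: (@le_lt_trans _ _ ((ratr q - l) * (`|d| + 1))).
    by rewrite ler_wpM2l ?lerDl// subr_ge0 ltW.
  by rewrite -ltr_pdivlMr// ltrBlDl.
move=> x e e0; have e20 : 0 < e / 2 by rewrite divr_gt0.
have [s /spanS/(_ 1)] := closure_norm (Dspan x I) e20.
rewrite scale1r => /(_ _ e20)[a Ea sa] xs; exists a => //.
rewrite -(subrKA s) (splitr e); apply: le_lt_trans (ler_normD _ _) _.
exact: ltrD.
Qed.

Theorem theorem4p2 (R : realType) :
  (forall (T : Type) (K : set T), infinite_set K ->
   forall X : normedModType R,
     lt_octahedral K X -> has_dens [set: X] K -> gamma_star X = 1%E) /\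
  (forall X : normedModType R,
     separable X -> octahedral X -> gamma_star X = 1%E).
Proof.
split=> [T K Kinf X Xoct [[D Dspan DK] _]|X [D Dcount Ddense] Xoct].
  move/card_eqPle: DK => [DleK KleD].
  have Dinf : infinite_set D.
    by apply/infiniteP/(card_le_trans _ KleD)/infiniteP.
  have [E Ed ED] := spanning_norm_dense Dinf Dspan.
  by apply: gamma_star_eq1 Kinf Xoct Ed _; exact: card_le_trans DleK.
apply: gamma_star_eq1 infinite_nat Xoct _ Dcount => x e e0.
have [|a [+ Da]] := Ddense _ _ (ball_open x e).
  by exists x; exact: (ballxx x e0).
by rewrite -ball_normE /= => xa; exists a.
Qed.
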